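(* Let $T=(V(T),E(T);f,g)$ be a weighted tree with two or more vertices and let $v_i$ be a fixed vertex of $T$. Consider the following procedure. Step 1 (initialize): set $p(v_s)=f(v_s)$ for all $v_s\in V(T)$. Step 2 (contract): (a) choose a pendant vertex $u\ne v_i$ of the current tree and let $e=(u,v)$ denote the pendant edge; (b) replace $p(v)$ with $p(v)(p(u)g(e)+1)$; (c) eliminate the vertex $u$ and the edge $e$. Step 3: if $v$ is the only remaining vertex $v_i$, go to Step 4; otherwise, go to Step 2. Step 4: answer $p(v)$. Then the answer of the procedure is the generating function of subtrees of $T$ containing $v_i$, i.e. $F(T;f,g;v_i)=p(v)$.
   Context: Let $\mathcal R$ be a commutative ring with unit element $1$. A weighted tree $T=(V(T),E(T);f,g)$ is a finite tree with a vertex-weight function $f:V(T)\to\mathcal R$ and an edge-weight function $g:E(T)\to\mathcal R$. A subtree of $T$ is a nonempty connected subgraph of $T$ (single vertices are allowed). The weight $\omega(T_1)$ of a subtree $T_1$ is the product of the weights of all vertices and edges of $T_1$. For a vertex $v_i$, $F(T;f,g;v_i)=\sum_{T_1}\omega(T_1)$, summed over all subtrees $T_1$ of $T$ containing $v_i$. A pendant vertex is a vertex of degree $1$; the edge incident to it is its pendant edge. *)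

(* Defs.v *)
From mathcomp Require Import all_boot all_order all_algebra.

Set Implicit Arguments.
Unset Strict Implicit.
Unset Printing Implicit Defensive.

Import GRing.Theory.
Local Open Scope ring_scope.

(* A graph is a vertex set and an edge set inside an ambient finite type V,
   so that the subgraphs of a graph and the successively contracted trees are
   again graphs over V. An edge is an unordered pair of distinct vertices. *)
Definition graph (V : finType) : Type := ({set V} * {set {set V}})%type.

Definition vertices (V : finType) (G : graph V) : {set V} := G.1.
Definition edges (V : finType) (G : graph V) : {set {set V}} := G.2.

Definition is_graph (V : finType) (G : graph V) : bool :=
  [forall e in edges G, (e \subset vertices G) && (#|e| == 2)%N].

Definition adj (V : finType) (G : graph V) : rel V :=
  [rel x y | [set x; y] \in edges G].

Definition connected_graph (V : finType) (G : graph V) : bool :=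
  (vertices G != set0) &&
  [forall x in vertices G, forall y in vertices G, connect (adj G) x y].

(* [ucycle] also accepts the empty sequence and the closed walk [:: x; y]
   along a single edge; neither is a cycle of a simple graph. *)
Definition acyclic_graph (V : finType) (G : graph V) : Prop :=
  forall c : seq V, ucycle (adj G) c -> (size c <= 2)%N.

Definition is_tree (V : finType) (G : graph V) : Prop :=
  [/\ is_graph G, connected_graph G & acyclic_graph G].

Definition subgraph (V : finType) (H G : graph V) : bool :=
  [&& is_graph H, vertices H \subset vertices G & edges H \subset edges G].

Definition subtree (V : finType) (H G : graph V) : bool :=
  subgraph H G && connected_graph H.

(* The weights f and g are total functions, but only their values on the
   vertices and the edges of the graph at hand are ever used. *)
Definition weight (R : comPzRingType) (V : finType)
    (f : V -> R) (g : {set V} -> R) (H : graph V) : R :=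
  (\prod_(v in vertices H) f v) * (\prod_(e in edges H) g e).

Definition subtree_gf (R : comPzRingType) (V : finType) (T : graph V)
    (f : V -> R) (g : {set V} -> R) (vi : V) : R :=
  \sum_(H : graph V | subtree H T && (vi \in vertices H)) weight f g H.

Definition degree (V : finType) (G : graph V) (u : V) : nat :=
  #|[set e in edges G | u \in e]|.

Definition pendant (V : finType) (G : graph V) (u : V) : bool :=
  (u \in vertices G) && (degree G u == 1)%N.

(* A state of the procedure: the current tree and the current values p. *)
Definition state (R : Type) (V : finType) : Type := (graph V * (V -> R))%type.

(* Step 2(a): u may be chosen, and [set u; v] is its pendant edge. *)
Definition choosable (V : finType) (vi : V) (G : graph V) (u v : V) : bool :=
  [&& pendant G u, u != vi & [set u; v] \in edges G].

(* Steps 2(b) and 2(c). *)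
Definition contract (R : comPzRingType) (V : finType) (g : {set V} -> R)
    (s : state R V) (u v : V) : state R V :=
  let: (G, p) := s in
  let e := [set u; v] in
  ((vertices G :\ u, edges G :\ e),
   fun x => if x == v then p v * (p u * g e + 1) else p x).

(* The test of Step 3, made after u has been contracted into v. *)
Definition finished (R : Type) (V : finType) (vi v : V) (s : state R V) : bool :=
  (v == vi) && (vertices s.1 == [set v]).

(* [answers g vi s a]: some run of the loop entered at Step 2 in state s
   stops and answers a. *)
Inductive answers (R : comPzRingType) (V : finType) (g : {set V} -> R)
    (vi : V) : state R V -> R -> Prop :=
| answers_stop (s : state R V) (u v : V) :
    choosable vi s.1 u v ->
    finished vi v (contract g s u v) ->
    answers g vi s ((contract g s u v).2 v)
| answers_loop (s : state R V) (u v : V) (a : R) :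
    choosable vi s.1 u v ->
    ~~ finished vi v (contract g s u v) ->
    answers g vi (contract g s u v) a ->
    answers g vi s a.

(* [terminates g vi s]: whatever pendant vertices are chosen, the loop entered
   at Step 2 in state s never lacks a vertex to choose and, the predicate being
   inductive, stops after finitely many iterations. *)
Inductive terminates (R : comPzRingType) (V : finType) (g : {set V} -> R)
    (vi : V) (s : state R V) : Prop :=
| Terminates :
    (exists u v : V, choosable vi s.1 u v) ->
    (forall u v : V, choosable vi s.1 u v ->
       ~~ finished vi v (contract g s u v) ->
       terminates g vi (contract g s u v)) ->
    terminates g vi s.

(* Main.v *)
Require Import Defs.
From mathcomp Require Import all_boot all_order all_algebra.

(** Contracting a leaf [u] into its neighbour [v] does not change the generating
    function.  A subtree through [vi] that contains [u <> vi] must contain the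
    pendant edge, so it is obtained from a subtree through [vi] and [v] of the
    contracted tree by attaching [u]; this multiplies the weight by
    [p u * g e].  Hence a subtree of the contracted tree through [v] accounts for
    itself and its extension, which is the factor [p u * g e + 1] put on [v].
    The procedure never gets stuck: in a tree with two vertices or more the end
    of a longest simple path issued from [vi] is a pendant vertex. *)

Set Implicit Arguments.
Unset Strict Implicit.
Unset Printing Implicit Defensive.

Import GRing.Theory.

(** * Graphs and their pendant vertices *)

Section Graphs.

Variable V : finType.
Implicit Types (G H T : graph V) (u v x y : V).

(** Degree one, expressed as uniqueness of the incident edge. The second clause passes to subgraphs,
    even those that miss [u], and several lemmas below assume it alone. *)
Definition leaf_at G u v : Prop :=
  [set u; v] \in edges G /\
  forall e, e \in edges G -> u \in e -> e = [set u; v].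

Definition del_leaf u v G : graph V :=
  (vertices G :\ u, edges G :\ [set u; v]).

Definition add_leaf u v H : graph V :=
  (u |: vertices H, [set u; v] |: edges H).

Lemma adj_sym G : symmetric (adj G).
Proof. by move=> x y; rewrite /adj /= setUC. Qed.

Lemma edge_sub G e : is_graph G -> e \in edges G -> e \subset vertices G.
Proof. by move=> /forall_inP hG /hG /andP[]. Qed.

Lemma adj_neq G x y : is_graph G -> adj G x y -> x != y.
Proof.
move=> /forall_inP hG /hG /andP[_]; rewrite cards2.
by case: (x != y).
Qed.

Lemma adj_vertices G x y :
  is_graph G -> adj G x y -> (x \in vertices G) && (y \in vertices G).
Proof.
move=> hG /(edge_sub hG) /subsetP sub.
by rewrite !sub // !inE eqxx ?orbT.
Qed.

Lemma adj_of_edge G e u :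
  is_graph G -> e \in edges G -> u \in e -> exists2 w, adj G u w & e = [set u; w].
Proof.
move=> /forall_inP hG he; have /andP[_ /cards2P[a [b [_ Ee]]]] := hG e he.
rewrite Ee !inE => /orP[] /eqP->.
  by exists b; rewrite // /adj /= -Ee.
by exists a; rewrite /adj /= setUC // -Ee.
Qed.

Lemma connected_adj G x y :
    connected_graph G -> x \in vertices G -> y \in vertices G -> x != y ->
  exists w, adj G x w.
Proof.
move=> /andP[_ /forall_inP hc] hx hy nxy.
have /forall_inP/(_ y hy)/connectP[[|w p] /=] := hc x hx.
  by move=> _ eyx; rewrite eyx eqxx in nxy.
by case/andP=> ? _ _; exists w.
Qed.

Lemma choosable_leaf vi G u v : choosable vi G u v -> leaf_at G u v.
Proof.
case/and3P=> /andP[_ /cards1P[e0 E]] _ he; split=> // e heG hue.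
have: e \in [set e in edges G | u \in e] by rewrite inE heG.
have: [set u; v] \in [set e in edges G | u \in e] by rewrite inE he !inE eqxx.
by rewrite E !inE => /eqP-> /eqP->.
Qed.

Lemma leaf_at_choosable vi G u v :
  is_graph G -> leaf_at G u v -> u != vi -> choosable vi G u v.
Proof.
move=> hG [he hu] nu; rewrite /choosable nu he !andbT /pendant.
have /andP[-> _] := adj_vertices hG he.
apply/cards1P; exists [set u; v]; apply/setP=> e; rewrite !inE.
apply/andP/eqP=> [[? ?]|->]; first exact: hu.
by rewrite he !inE eqxx.
Qed.

Lemma leaf_adj G u v x : leaf_at G u v -> adj G u x -> x = v.
Proof.
move=> [_ hu] h; have /setP E := hu _ h (set21 _ _).
have := E v; have := E x; rewrite !inE !eqxx !orbT.
move=> /esym/orP[]/eqP-> //.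
(* Degenerate case [x = u]: then [[set u; v]] is the singleton of [u], so [v = u]. *)
by rewrite orbb => /eqP.
Qed.

(** * Deleting a leaf *)

Lemma connect_del_leaf H u v x y :
    (forall e, e \in edges H -> u \in e -> e = [set u; v]) ->
    x != u -> y != u -> connect (adj H) x y ->
  connect (adj (del_leaf u v H)) x y.
Proof.
move=> hu nx ny hxy.
(* Fold the leaf onto its neighbour: this maps each edge to an edge or a point. *)
pose h z := if z == u then v else z.
have step a b : adj H a b -> connect (adj (del_leaf u v H)) (h a) (h b).
  move=> hab; rewrite /h.
  have [Eab|nab] := eqVneq [set a; b] [set u; v].
    have: a \in [set u; v] by rewrite -Eab set21.
    have: b \in [set u; v] by rewrite -Eab set22.
    rewrite !inE => Hb Ha.
    have fold c : (c == u) || (c == v) -> (if c == u then v else c) = v.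
      by case: (c == u) => //= /eqP.
    by rewrite !fold.
  have na : a != u.
    by apply: contraNneq nab => Ea; rewrite (hu _ hab) // Ea set21.
  have nb : b != u.
    by apply: contraNneq nab => Eb; rewrite (hu _ hab) // Eb set22.
  rewrite (negPf na) (negPf nb); apply: connect1.
  by rewrite /adj /= !inE nab.
suff: connect (adj (del_leaf u v H)) (h x) (h y).
  by rewrite /h (negPf nx) (negPf ny).
case/connectP: hxy => p; elim: p x {nx ny} => [|z p IH] x /= => [_ ->|].
  exact: connect0.
case/andP=> hxz hp Ey; exact: connect_trans (step _ _ hxz) (IH _ hp Ey).
Qed.

Lemma connected_del_leaf H u v x :
    (forall e, e \in edges H -> u \in e -> e = [set u; v]) ->
    x \in vertices H -> x != u -> connected_graph H ->
  connected_graph (del_leaf u v H).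
Proof.
move=> hu hx nx /andP[_ /forall_inP hc]; apply/andP; split.
  by apply/set0Pn; exists x; rewrite !inE nx.
apply/forall_inP=> a /setD1P[na ha]; apply/forall_inP=> b /setD1P[nb hb].
by apply: connect_del_leaf => //; move/forall_inP: (hc a ha); apply.
Qed.

Lemma is_graph_del_leaf H u v :
    (forall e, e \in edges H -> u \in e -> e = [set u; v]) ->
  is_graph H -> is_graph (del_leaf u v H).
Proof.
move=> hu /forall_inP hH; apply/forall_inP=> e /setD1P[ne he].
have /andP[sub ->] := hH e he; rewrite andbT.
apply/subsetP=> x hx; rewrite !inE (subsetP sub) // andbT.
by apply: contraNneq ne => Ex; rewrite (hu e he) // -Ex.
Qed.

(** Avoiding [u] already forces avoiding the edge [[set u; v]], because the ends of an edge of [H]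
    are vertices of [H]. *)
Lemma subtree_del_leaf T H u v :
  leaf_at T u v ->
  subtree H (del_leaf u v T) = subtree H T && (u \notin vertices H).
Proof.
move=> [he hu]; rewrite /subtree /subgraph /=.
case hH: (is_graph H) => //=; case: (connected_graph H); last by rewrite !andbF.
rewrite !andbT !subsetD1.
case: (vertices H \subset vertices T); rewrite //=.
case: (edges H \subset edges T); rewrite /= ?andbF //.
case hV: (u \in vertices H) => //=; apply/negP=> h.
by have /andP[] := adj_vertices hH h; rewrite hV.
Qed.

Lemma is_tree_del_leaf T u v x :
    leaf_at T u v -> x \in vertices T -> x != u -> is_tree T ->
  is_tree (del_leaf u v T).
Proof.
move=> [_ hu] hx nx [hG hC hA]; split.
- exact: is_graph_del_leaf.
- exact: connected_del_leaf hx nx hC.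
move=> c /andP[hc hun]; apply: hA; apply/andP; split=> //.
case: c hc {hun} => //= z c; apply: sub_path => a b.
by rewrite /adj /= !inE => /andP[].
Qed.

(** * Attaching a leaf *)

Lemma add_leafK H u v :
    (u \notin vertices H) -> is_graph H ->
  del_leaf u v (add_leaf u v H) = H.
Proof.
move=> huV hH; have he : [set u; v] \notin edges H.
  by apply: contra huV => h; have /andP[] := adj_vertices hH h.
case: H huV he {hH} => W E huV he.
by rewrite /del_leaf /add_leaf /= !setU1K.
Qed.

(** Connectedness gives [u] a neighbour in [H], since [x] is another vertex, and the only neighbour
    of [u] in [T] is [v]. *)
Lemma subtree_leaf_edge T H u v x :
    leaf_at T u v -> subtree H T -> u \in vertices H ->
    x \in vertices H -> u != x ->
  [set u; v] \in edges H.
Proof.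
move=> hl /andP[/and3P[_ _ /subsetP sub] hC] hu hx nux.
have [w hw] := connected_adj hC hu hx nux.
by rewrite -(leaf_adj hl (sub _ hw)).
Qed.

Lemma del_leafK T H u v x :
    leaf_at T u v -> subtree H T -> u \in vertices H ->
    x \in vertices H -> u != x ->
  add_leaf u v (del_leaf u v H) = H.
Proof.
move=> hl hH hu hx nux; have := subtree_leaf_edge hl hH hu hx nux.
case: H hu {hH hx} => W E hu hE.
by rewrite /del_leaf /add_leaf /= !setD1K.
Qed.

Lemma connected_add_leaf H u v :
  v \in vertices H -> connected_graph H -> connected_graph (add_leaf u v H).
Proof.
move=> hv /andP[_ /forall_inP hc]; apply/andP; split.
  by apply/set0Pn; exists u; rewrite !inE eqxx.
have sym : connect_sym (adj (add_leaf u v H)).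
  exact/sym_connect_sym/adj_sym.
have to_v a : a \in vertices (add_leaf u v H) ->
    connect (adj (add_leaf u v H)) a v.
  case/setU1P=> [->|ha]; first by apply: connect1; rewrite /adj /= setU11.
  move/forall_inP: (hc a ha) => /(_ v hv); apply: connect_sub => b c hbc.
  by apply: connect1; rewrite /adj /= inE [_ \in edges H]hbc orbT.
apply/forall_inP=> a ha; apply/forall_inP=> b hb.
by apply: connect_trans (to_v a ha) _; rewrite sym to_v.
Qed.

Lemma is_graph_add_leaf H u v :
  u != v -> v \in vertices H -> is_graph H -> is_graph (add_leaf u v H).
Proof.
move=> nuv hv /forall_inP hH; apply/forall_inP=> e /setU1P[->|/hH/andP[sub ->]].
  by rewrite cards2 nuv andbT subUset !sub1set !inE eqxx hv orbT.
by rewrite andbT (subset_trans sub) // subsetUr.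
Qed.

(** Shaped for [reindex_onto]: up to the evident membership of [u], the left side is the condition
    that the change of variable produces. Its last conjunct discards every [H] that already contains
    [u]. *)
Lemma subtree_add_leaf T H u v x :
    is_graph T -> leaf_at T u v -> x != u ->
  [&& subtree (add_leaf u v H) T, x \in vertices (add_leaf u v H)
    & del_leaf u v (add_leaf u v H) == H]
  = [&& subtree H (del_leaf u v T), x \in vertices H & v \in vertices H].
Proof.
move=> hT hl nx; have [he hu] := hl; have nuv := adj_neq hT he.
apply/and3P/and3P=> [[hA hx /eqP E]|[hH hx hv]].
  have /andP[/and3P[hG hVs hEs] hC] := hA.
  have hu' e : e \in edges (add_leaf u v H) -> u \in e -> e = [set u; v].
    by move/(subsetP hEs); apply: hu.
  have nuH : u \notin vertices H by rewrite -E !inE eqxx.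
  have hxH : x \in vertices H by move: hx; rewrite !inE (negPf nx).
  split=> //.
    rewrite subtree_del_leaf // nuH andbT; apply/andP; split; last first.
      by rewrite -E; apply: connected_del_leaf hx nx hC.
    apply/and3P; split; first by rewrite -E; apply: is_graph_del_leaf.
      exact: subset_trans (subsetUr _ _) hVs.
    exact: subset_trans (subsetUr _ _) hEs.
  (* The pendant edge belongs to the graph [add_leaf u v H], so its end [v] is a vertex there, hence
     a vertex of [H] as [v] differs from [u]. *)
  have /andP[_] : (u \in vertices (add_leaf u v H)) &&
                  (v \in vertices (add_leaf u v H)).
    by apply: adj_vertices hG _; rewrite /adj /= setU11.
  by rewrite !inE eq_sym (negPf nuv).
move: hH; rewrite subtree_del_leaf // => /andP[/andP[/and3P[hG hVs hEs] hC] huH].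
split; last by rewrite add_leafK.
- apply/andP; split; last exact: connected_add_leaf.
  apply/and3P; split; first exact: is_graph_add_leaf.
    rewrite subUset sub1set hVs andbT.
    by have /andP[] := adj_vertices hT he.
  by rewrite subUset sub1set he.
- by rewrite !inE hx orbT.
Qed.

(** * Existence of a pendant vertex *)

Lemma tree_has_leaf T vi :
    is_tree T -> vi \in vertices T -> 2 <= #|vertices T| ->
  exists u v, choosable vi T u v.
Proof.
move=> [hG hC hA] hvi hcard.
(* Here [n] counts edges; a simple path visits [n + 1] distinct vertices, which bounds [n] and
   yields a maximum. *)
pose good n := [exists t : n.-tuple V, path (adj T) vi t && uniq (vi :: t)].
have good1 : good 1.
  have /set0Pn[y /setD1P[nyvi hy]] : vertices T :\ vi != set0.
    by rewrite -card_gt0; move: hcard; rewrite (cardsD1 vi) hvi.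
  have [w hw] : exists w, adj T vi w.
    by apply: connected_adj hC hvi hy _; rewrite eq_sym.
  apply/existsP; exists [tuple w]; rewrite /= inE !andbT.
  by apply/andP; split; [exact: hw | exact: adj_neq hG hw].
have bound n : good n -> n <= #|V|.
  case/existsP=> t /andP[_ /card_uniqP/=]; rewrite size_tuple => E.
  by apply: leq_trans (leqnSn n) _; rewrite -E max_card.
have ex_good : exists n, good n by exists 1.
have [n /existsP[t /andP[hp hun]] nmax] := ex_maxnP ex_good bound.
have n_gt0 := nmax _ good1.
have maxt q : path (adj T) vi q -> uniq (vi :: q) -> size q <= n.
  move=> hq uq; apply: nmax; apply/existsP; exists (in_tuple q).
  by rewrite hq uq.
have: size t = n := size_tuple t.
move: (tval t) hp hun => {t} s; case/lastP: s => [|s u] hp hun hs.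
  by rewrite -hs in n_gt0.
have {nmax n_gt0 bound good1} nu : u != vi.
  by move: hun; rewrite /= mem_rcons inE negb_or eq_sym => /andP[/andP[]].
pose v := last vi s; exists u, v; apply: leaf_at_choosable => //.
move: (hp); rewrite rcons_path => /andP[hps hvu].
split; first by rewrite setUC; exact: hvu.
move=> e he hue; have [w huw ->] := adj_of_edge hG he hue.
congr [set u; _]; apply/eqP; apply/idPn=> nwv.
have nuw := adj_neq hG huw.
have hwp : w \in vi :: rcons s u.
  (* Off the path, [w] would prolong it beyond the maximal length. *)
  apply/idPn=> hw; have := maxt (rcons (rcons s u) w).
  rewrite rcons_path hp last_rcons huw -rcons_cons rcons_uniq hw hun.
  by rewrite size_rcons hs ltnn => /(_ isT isT).
have {}hwp : w \in vi :: s.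
  by move: hwp; rewrite -rcons_cons mem_rcons inE eq_sym (negPf nuw).
(* Otherwise [w] lies on the path before [v], and closes a cycle through [u]. *)
case/splitPl: hwp @v hps hvu hp hun nwv hs => s1 s2 Ew.
rewrite last_cat Ew cat_path Ew => v /andP[_ hp2] hvu _ hun nwv _.
have huc : ucycle (adj T) (w :: rcons s2 u).
  rewrite /ucycle /= -cats1 -cats1 -catA cat_path hp2 /= hvu huw /=.
  move: hun; rewrite -cats1 -catA -cat_cons lastI Ew cat_rcons cat_uniq.
  by case/and3P.
(* The cycle has [size s2 + 2] vertices, so acyclicity leaves only [s2] empty, that is [w = v],
   against [nwv]. *)
have := hA _ huc; case: {hp2 hvu hun huc} s2 @v nwv => /= [|b s2].
  by rewrite eqxx.
by rewrite size_rcons.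
Qed.

End Graphs.

(** * Generating functions under contraction *)

Section GeneratingFunction.

Local Open Scope ring_scope.

Variables (R : comPzRingType) (V : finType) (g : {set V} -> R) (vi : V).
Implicit Types (G H T : graph V) (p : V -> R) (u v x y : V).

Definition contracted_weight p u v : V -> R :=
  fun x => if x == v then p v * (p u * g [set u; v] + 1) else p x.

Lemma contractE G p u v :
  contract g (G, p) u v = (del_leaf u v G, contracted_weight p u v).
Proof. by []. Qed.

Lemma weight_add_leaf p H u v :
    u \notin vertices H -> is_graph H ->
  weight p g (add_leaf u v H) = p u * g [set u; v] * weight p g H.
Proof.
move=> hu hH; have he : [set u; v] \notin edges H.
  by apply: contra hu => h; have /andP[] := adj_vertices hH h.
by rewrite /weight /= !big_setU1 //= mulrACA.
Qed.

Lemma weight_contracted p H u v :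
    u \notin vertices H -> is_graph H ->
  weight (contracted_weight p u v) g H =
  weight p g H + (if v \in vertices H then weight p g (add_leaf u v H) else 0).
Proof.
move=> hu hH; case: ifP => hv; last first.
  rewrite addr0 /weight; congr (_ * _); apply: eq_bigr => x hx.
  by rewrite /contracted_weight; case: eqP => // Ex; rewrite -Ex hx in hv.
(* Isolate the factor at [v], the only vertex where the two weightings can differ. *)
rewrite weight_add_leaf // /weight !(bigD1 (P := [in vertices H]) v) //=.
rewrite /contracted_weight eqxx.
under eq_bigr => x /andP[_ /negPf->] do [].
by rewrite [p v * _]mulrC mulrDl mul1r addrC !mulrDl -!mulrA.
Qed.

Lemma subtree_gf_contract T p u v :
    is_graph T -> leaf_at T u v -> u != vi ->
  subtree_gf T p g vi =
  subtree_gf (del_leaf u v T) (contracted_weight p u v) g vi.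
Proof.
move=> hT hl nu; rewrite /subtree_gf.
(* The subtrees of [T] that avoid [u] come first; they are the subtrees of the contracted tree. *)
rewrite (bigID (fun H : graph V => u \notin vertices H)) /=.
under [RHS]eq_bigr => H /andP[hH _].
  move: hH; rewrite subtree_del_leaf // => /andP[/andP[/and3P[hG _ _] _] huH].
  rewrite weight_contracted //; over.
(* The [if] of [weight_contracted] becomes a filter: the second sum runs over the subtrees through
   [v], to be matched with those of [T] that contain [u]. *)
rewrite big_split -big_mkcondr /=; congr (_ + _).
  by apply: eq_bigl => H; rewrite subtree_del_leaf // andbAC.
(* Attaching and deleting the leaf are inverse bijections between these two families. *)
rewrite (reindex_onto (add_leaf u v) (del_leaf u v)) /=; last first.
  move=> H /andP[/andP[hH hvi] /negPn hu].
  exact: del_leafK hl hH hu hvi nu.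
apply: eq_bigl => H; have := subtree_add_leaf H hT hl (x := vi).
rewrite eq_sym nu => /(_ isT); rewrite -!andbA => <-.
by rewrite /= !inE eqxx.
Qed.

(** A single vertex leaves no room for an edge, so [T] is its own only subtree through [vi]. *)
Lemma subtree_gf_single T p :
  is_tree T -> vertices T = [set vi] -> subtree_gf T p g vi = p vi.
Proof.
move=> [hG hC _] hV; rewrite /subtree_gf.
have hE : edges T = set0.
  apply/setP=> e; rewrite inE; apply/negP=> he.
  move/forall_inP/(_ e he): hG; rewrite hV => /andP[/subset_leq_card].
  by rewrite cards1 => le /eqP E; rewrite E in le.
rewrite (big_pred1 T) => [|H].
  by rewrite /weight hV hE big_set1 big_set0 mulr1.
apply/andP/eqP=> [[/andP[/and3P[_ sV sE] _] hvi]|->]; last first.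
  by rewrite /subtree /subgraph hG hC !subxx hV set11.
case: H T hV hE sV sE hvi {hG hC} => [W E] [W' E'] /= -> ->.
rewrite subset0 subset1 => /orP[]/eqP-> /eqP-> //.
by rewrite inE.
Qed.

(** * The loop invariant, termination and correctness *)

Definition ready T := [/\ is_tree T, vi \in vertices T & (2 <= #|vertices T|)%N].

(** Both [vi] and [v] survive the contraction, so if at most one vertex is left it is [v = vi] and
    the test succeeds. The first two conclusions also cover the final state, where the invariant is
    lost. *)
Lemma ready_contract T p u v :
    ready T -> choosable vi T u v ->
  [/\ is_tree (del_leaf u v T), vi \in vertices (del_leaf u v T) &
      ~~ finished vi v (contract g (T, p) u v) -> ready (del_leaf u v T)].
Proof.
move=> [hT hvi hcard] hch; have hl := choosable_leaf hch.
have /and3P[_ nu he] := hch; have [hG _ _] := hT.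
have nvu : vi != u by rewrite eq_sym.
have hT' := is_tree_del_leaf hl hvi nvu hT.
have hvi' : vi \in vertices (del_leaf u v T) by rewrite !inE nvu.
split=> // nfin; split=> //; rewrite ltnNge; apply: contra nfin => le1.
have hv' : v \in vertices (del_leaf u v T).
  have /andP[_ hv] := adj_vertices hG he.
  by rewrite !inE eq_sym (adj_neq hG he).
have E := card_le1_eqP le1; rewrite contractE /finished /= (E _ _ hvi' hv') eqxx.
by apply/eqP/setP=> x; rewrite in_set1; apply/idP/eqP=> [hx|->]; first exact: E.
Qed.

Lemma ready_terminates T p : ready T -> terminates g vi (T, p).
Proof.
(* Induction on a strict bound for the number of vertices, which drops by one at each
   contraction. *)
have [n le_n] := ubnP #|vertices T|.
elim: n T p le_n => [|n IH] T p le_n hr; first by rewrite ltn0 in le_n.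
have [hT hvi hcard] := hr; split; first exact: (tree_has_leaf hT hvi hcard).
move=> u v hch nfin; have [_ _ /(_ nfin) hr'] := ready_contract p hr hch.
rewrite contractE; apply: (IH _ _ _ hr'); rewrite ltnS in le_n.
apply: leq_trans le_n; rewrite [X in (_ <= X)%N](cardsD1 u).
by case/and3P: hch => /andP[->].
Qed.

Lemma ready_answers T p a :
  ready T -> answers g vi (T, p) a -> subtree_gf T p g vi = a.
Proof.
(* The state is named so that the induction on the run can vary both the tree and the weights. *)
move=> hr ha; move Es: (T, p) ha => s ha; elim: ha T p Es hr => {s a}.
  move=> s u v hch fin T p Es hr; rewrite -Es /= in hch fin *.
  have [hT' hvi' _] := ready_contract p hr hch; have [[hG _ _] _ _] := hr.
  have /and3P[_ nu _] := hch.
  rewrite (subtree_gf_contract _ hG (choosable_leaf hch) nu).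
  (* The successful test leaves the single vertex [v = vi], whose current weight is the generating
     function. *)
  have /andP[/eqP Ev /eqP EV] := fin.
  by rewrite subtree_gf_single // ?Ev // /contracted_weight -Ev.
move=> s u v a hch nfin _ IH T p Es hr; rewrite -Es /= in hch nfin IH.
have [_ _ /(_ nfin) hr'] := ready_contract p hr hch; have [[hG _ _] _ _] := hr.
have /and3P[_ nu _] := hch.
rewrite (subtree_gf_contract _ hG (choosable_leaf hch) nu).
exact: IH hr'.
Qed.

End GeneratingFunction.

(** Termination under every choice provides an answer, so the second conjunct is not vacuous. *)
Theorem mainTheorem2 (R : comPzRingType) (V : finType) (T : graph V)
    (f : V -> R) (g : {set V} -> R) (vi : V)
    (hT : is_tree T) (hcard : 2 <= #|vertices T|) (hvi : vi \in vertices T) :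
  terminates g vi (T, f) /\
  (forall a : R, answers g vi (T, f) a -> subtree_gf T f g vi = a).
Proof.
have hr : ready vi T by [].
by split=> [|a]; [apply: ready_terminates | apply: ready_answers].
Qed.
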